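(* Let $D$ be an integral domain which is not quasi-local and let $\mathcal{X}$ be a property of integral domains. Then $D$ is a locally $\mathcal{X}$-domain if and only if the Nagata transform $T(a)$ is a locally $\mathcal{X}$-domain for every nonunit element $a\in D$.
   Context: Properties of integral domains are understood to be invariant under ring isomorphism. A domain is quasi-local if it has exactly one maximal ideal. A domain $D$ is a locally $\mathcal{X}$-domain if $D_P$ has the property $\mathcal{X}$ for every prime ideal $P$ of $D$. For an ideal $I$ of a domain $D$ with quotient field $K$, the Nagata (ideal) transform of $I$ is the overring $T(I)=\bigcup_{n=0}^{\infty}(D:I^n)=\bigcup_{n=0}^\infty\{x\in K \mid xI^n\subseteq D\}$ of $D$; for $a\in D$, $T(a)$ denotes $T((a))$. *)

(* Defs.v *)
From HB Require Import structures.
From mathcomp Require Import all_boot all_algebra.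
From mathcomp Require Import boolp.
Set Implicit Arguments.
Unset Strict Implicit.
Unset Printing Implicit Defensive.
Import GRing.Theory.
Local Open Scope ring_scope.

(* Subsets are collective predicates [{pred T}], as for MathComp's own [idealr]
   and [prime_idealr]; since [`[< P >]] reflects every proposition, they range
   over all subsets. *)

Section Ideals.
Variable D : idomainType.

(* [idealr D] is the type of proper ideals of [D]. *)
Definition maximal_ideal (M : idealr D) : Prop :=
  forall J : idealr D, {subset M <= J} -> J =i M.

Definition quasi_local : Prop :=
  exists M : idealr D,
    maximal_ideal M /\ forall N : idealr D, maximal_ideal N -> N =i M.

Definition principal_ideal (a : D) : {pred D} :=
  [pred x | `[< exists r : D, x = r * a >]].

Definition ideal_mul (I J : {pred D}) : {pred D} :=
  [pred x | `[< exists s : seq (D * D),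
                  {in s, forall p, p.1 \in I /\ p.2 \in J} /\
                  x = \sum_(p <- s) p.1 * p.2 >]].

(* [I^0 = D] and [I^(n+1) = I I^n]; for an arbitrary subset [I] and [n > 0] this
   is the [n]-th power of the ideal generated by [I]. *)
Definition ideal_exp (I : {pred D}) (n : nat) : {pred D} :=
  iter n (ideal_mul I) predT.

(* [(D : J)] inside the quotient field of [D]. *)
Definition colon (J : {pred D}) : {pred {fraction D}} :=
  [pred x | `[< forall j, j \in J -> exists d : D, x * tofrac j = tofrac d >]].

End Ideals.

Section SubringDomain.
Variables (K : fieldType) (S : subringClosed K).

Record subring_dom := SubringDom {
  subring_val :> K;
  _ : subring_val \in S
}.

HB.instance Definition _ := [isSub for subring_val].
HB.instance Definition _ := [Choice of subring_dom by <:].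
HB.instance Definition _ := [SubChoice_isSubComNzRing of subring_dom by <:].

Definition subring_unit : pred subring_dom :=
  [pred u | (\val u != 0) && ((\val u)^-1 \in S)].

Definition subring_inv (u : subring_dom) : subring_dom := insubd u (\val u)^-1.

Fact subring_mulVr : {in subring_unit, left_inverse 1 subring_inv *%R}.
Proof.
move=> u /andP[u0 uS]; apply: val_inj.
by rewrite rmorphM rmorph1 /= insubdK // mulVf.
Qed.

Fact subring_unitP u v : v * u = 1 -> subring_unit u.
Proof.
move=> /(congr1 \val); rewrite rmorphM rmorph1 /= => vu1.
have u0 : subring_val u != 0.
  by apply/eqP => u0; move/eqP: vu1; rewrite u0 mulr0 eq_sym oner_eq0.
apply/andP; split=> //; suff -> : (subring_val u)^-1 = subring_val v by exact: valP.
by rewrite -[LHS]mul1r -vu1 mulfK.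
Qed.

Fact subring_inv_out : {in [predC subring_unit], subring_inv =1 id}.
Proof.
move=> u; rewrite inE /= negb_and negbK => /orP[/eqP u0|uS].
  by apply: val_inj; rewrite val_insubd u0 invr0 if_same.
by apply: val_inj; rewrite val_insubd (negPf uS).
Qed.

HB.instance Definition _ := GRing.ComNzRing_hasMulInverse.Build subring_dom
  subring_mulVr subring_unitP subring_inv_out.

Fact subring_integral : GRing.integral_domain_axiom subring_dom.
Proof.
move=> u v /(congr1 \val)/eqP; rewrite rmorphM rmorph0 mulf_eq0.
by rewrite -!(inj_eq val_inj) rmorph0.
Qed.

HB.instance Definition _ :=
  GRing.ComUnitRing_isIntegral.Build subring_dom subring_integral.

End SubringDomain.

Section Localization.
Variables (D : idomainType) (P : prime_idealr D).

Definition localization_set : {pred {fraction D}} :=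
  [pred x | `[< exists a s : D, s \notin P /\ x = tofrac a / tofrac s >]].

Fact localization_subring : subring_closed localization_set.
Proof.
have nz s : s \notin P -> tofrac s != 0.
  by apply: contraNneq => /eqP; rewrite tofrac_eq0 => /eqP ->; rewrite rpred0.
split=> [|x y /asboolP[a [s [sP ->]]] /asboolP[b [t [tP ->]]]
         |x y /asboolP[a [s [sP ->]]] /asboolP[b [t [tP ->]]]]; apply/asboolP.
- by exists 1, 1; rewrite idealr1 tofrac1 divr1.
- exists (a * t - b * s), (s * t); rewrite prime_idealrM (negPf sP) (negPf tP).
  by rewrite -mulNr addf_div ?nz // !(tofracD, tofracN, tofracM) mulNr.
- exists (a * b), (s * t); rewrite prime_idealrM (negPf sP) (negPf tP).
  by rewrite !tofracM mulf_div.
Qed.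

HB.instance Definition _ := GRing.isSubringClosed.Build {fraction D}
  localization_set localization_subring.

Definition localization : idomainType := subring_dom localization_set.

End Localization.

Section NagataTransform.
Variables (D : idomainType) (I : {pred D}).

Definition nagata_set : {pred {fraction D}} :=
  [pred x | `[< exists n : nat, x \in colon (ideal_exp I n) >]].

Let mul_ideal (J : {pred D}) n d x : x \in ideal_exp J n -> d * x \in ideal_exp J n.
Proof.
elim: n d x => [//|n IH] d x /asboolP[s [sI ->]]; apply/asboolP.
exists [seq (p.1, d * p.2) | p <- s]; split.
  by move=> _ /mapP[p /sI[pI pJ] ->]; split=> //; exact: IH.
by rewrite big_map mulr_sumr; apply: eq_bigr => p _; rewrite mulrCA.
Qed.

Let exp_decr m n x : x \in ideal_exp I (m + n) -> x \in ideal_exp I n.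
Proof.
have exp0 k : 0 \in ideal_exp I k.
  by case: k => // k; apply/asboolP; exists [::]; rewrite big_nil; split.
have expD k : {in ideal_exp I k &, forall u v, u + v \in ideal_exp I k}.
  case: k => // k u v /asboolP[s [sI ->]] /asboolP[t [tI ->]]; apply/asboolP.
  exists (s ++ t); split; last by rewrite big_cat.
  by move=> p; rewrite mem_cat => /orP[/sI|/tI].
elim: m x => [//|m IH] x /asboolP[s [sI ->]].
rewrite big_seq; apply: (big_ind (fun y => y \in ideal_exp I n)) => //; first
  exact: expD.
by move=> p /sI[_ /IH]; exact: mul_ideal.
Qed.

(* [x I^m <= D] and [y I^n <= D] imply [x y I^(m+n) <= D]. *)
Let colonM m n x y : x \in colon (ideal_exp I m) -> y \in colon (ideal_exp I n) ->
  x * y \in colon (ideal_exp I (m + n)).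
Proof.
move=> /asboolP xm /asboolP yn; apply/asboolP.
suff H k z : z \in ideal_exp I (k + n) ->
    exists2 c, c \in ideal_exp I k & y * tofrac z = tofrac c.
  by move=> j /H[c /xm[d xc] yj]; exists d; rewrite -mulrA yj.
elim: k z => [|k IH] z; first by case/yn => c ->; exists c.
case/asboolP => s [sI ->] {z}.
elim: s sI => [|p s IHs] sI.
  exists 0; last by rewrite big_nil rmorph0 mulr0.
  by apply/asboolP; exists [::]; rewrite big_nil; split.
have [|c /asboolP[t [tI ->]] yc] := IHs.
  by move=> q qs; apply: sI; rewrite inE qs orbT.
have [p1 /IH[e ek ye]] := sI p (mem_head _ _).
exists (p.1 * e + \sum_(q <- t) q.1 * q.2).
  apply/asboolP; exists ((p.1, e) :: t); rewrite big_cons; split=> // q.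
  by rewrite inE => /orP[/eqP -> //|/tI].
by rewrite big_cons !rmorphD mulrDr yc /= tofracM mulrCA ye -tofracM.
Qed.

Fact nagata_subring : subring_closed nagata_set.
Proof.
split=> [|x y /asboolP[m xm] /asboolP[n yn]
         |x y /asboolP[m xm] /asboolP[n yn]]; apply/asboolP.
- by exists 0; apply/asboolP => j _; exists j; rewrite mul1r.
- exists (m + n)%N; apply/asboolP => j jmn.
  move/asboolP: xm => /(_ j)[|d xd]; first by apply: (@exp_decr n); rewrite addnC.
  move/asboolP: yn => /(_ j)[|e ye]; first exact: (@exp_decr m).
  by exists (d - e); rewrite mulrBl xd ye rmorphB.
- by exists (m + n)%N; exact: colonM.
Qed.

HB.instance Definition _ := GRing.isSubringClosed.Build {fraction D}
  nagata_set nagata_subring.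

Definition nagata_transform : idomainType := subring_dom nagata_set.

End NagataTransform.

Definition iso_invariant (X : idomainType -> Prop) : Prop :=
  forall R S : idomainType,
    (exists f : {rmorphism R -> S}, bijective f) -> X R -> X S.

Definition locally (X : idomainType -> Prop) (D : idomainType) : Prop :=
  forall P : prime_idealr D, X (localization P).

(* Main.v *)
Require Import Defs.
From HB Require Import structures.
From mathcomp Require Import all_boot all_algebra.
From mathcomp Require Import boolp.
Set Implicit Arguments.
Unset Strict Implicit.
Unset Printing Implicit Defensive.
Import GRing.Theory.
Local Open Scope ring_scope.

(** For a nonzero element [a] the transform [T(a)] is [D[1/a]], and [T(0)] is the
    whole quotient field of [D]; either way [T(a)] is a ring of fractions of [D]:
    each of its elements is [d / u] with [d], [u] in [D] and [u] invertible in
    [T(a)] ([nagata_principal_fraction]).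

    Localizing a ring of fractions [T] gives nothing new: if a prime [Q] of [T]
    lies over the prime [P] of [D], then [T_Q] and [D_P] are the same subring of
    the common quotient field, because [u] is outside [Q] whenever [1 / u] is in
    [T] ([lies_over_localization]). Hence a property inherited by every [D_P]
    passes to every localization of [T(a)], since each prime of [T(a)] lies over
    its contraction ([contraction_prime]).

    Conversely, a prime [P] of [D] is reached from [T(a)] as soon as [a] is not
    in [P]: then [T(a)] is contained in [D_P], and the elements of [T(a)] that
    are nonunits of [D_P] form a prime lying over [P] ([extension_prime]). A
    nonunit [a] outside [P] exists because otherwise [P] would consist of all the
    nonunits, making [D] quasi-local ([nonunit_notin_ideal]).

    The quotient field of [T] is built as a type of its own, so the identification
    of [T_Q] with [D_P] is the restriction of the field morphism
    [{fraction T} -> {fraction D}] that extends the inclusion of [T]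
    ([fraction_extension]). *)

(** * Fraction fields and isomorphisms *)

Lemma fractionP (R : idomainType) (x : {fraction R}) :
  exists a b : R, b != 0 /\ x = tofrac a / tofrac b.
Proof.
elim/quotW: x => r; exists r.1, r.2; split; first exact: denom_ratioP.
apply: (canRL (mulfK _)); first by rewrite tofrac_eq0 denom_ratioP.
unlock FracField.tofrac; rewrite -[LHS]FracField.pi_mul; apply/eqmodP.
rewrite /= FracField.equivfE /FracField.mulf /=.
by rewrite !numden_Ratio ?mulr1 ?oner_neq0 ?denom_ratioP // mulrC.
Qed.

(** Universal property of the fraction field: [a / b] must go to [g a / g b],
    which makes sense because injectivity keeps [g b] nonzero. *)
Lemma fraction_extension (R : idomainType) (F : fieldType)
    (g : {rmorphism R -> F}) : injective g ->
  exists h : {rmorphism {fraction R} -> F}, forall a, h (tofrac a) = g a.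
Proof.
move=> g_inj.
have g0 b : b != 0 -> g b != 0 by rewrite -(inj_eq g_inj) rmorph0.
(* Choose a value for each fraction from some representative; cross
   multiplication shows that it does not depend on the representative. *)
have [h hE] : exists h : {fraction R} -> F,
    forall a b, b != 0 -> h (tofrac a / tofrac b) = g a / g b.
  have /choice[h hP] (x : {fraction R}) : exists y : F, exists a b : R,
      [/\ b != 0, x = tofrac a / tofrac b & y = g a / g b].
    by have [a [b [b0 ->]]] := fractionP x; exists (g a / g b), a, b.
  exists h => a b b0; have [c [d [d0 /eqP + ->]]] := hP (tofrac a / tofrac b).
  rewrite !eqr_div ?tofrac_eq0 // -!tofracM tofrac_eq => /eqP e.
  by apply/eqP; rewrite eqr_div ?g0 // -!rmorphM e.
have hB : zmod_morphism h.
  move=> x y; have [a [b [b0 ->]]] := fractionP x.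
  have [c [d [d0 ->]]] := fractionP y.
  rewrite -mulNr addf_div ?tofrac_eq0 // -tofracN -!tofracM -tofracD.
  rewrite !hE ?mulf_neq0 // -mulNr addf_div ?g0 //.
  by rewrite rmorphD !rmorphM rmorphN.
have hM : monoid_morphism h.
  split=> [|x y].
    by rewrite -(divr1 1) -tofrac1 hE ?oner_neq0 // rmorph1 divr1.
  have [a [b [b0 ->]]] := fractionP x; have [c [d [d0 ->]]] := fractionP y.
  by rewrite mulf_div -!tofracM !hE ?mulf_neq0 // mulf_div !rmorphM.
pose zm := GRing.isZmodMorphism.Build _ _ h hB.
pose mm := GRing.isMonoidMorphism.Build _ _ h hM.
pose hr : {rmorphism {fraction R} -> F} := HB.pack h zm mm.
exists hr => a.
by rewrite -[tofrac a]divr1 -tofrac1 [LHS]hE ?oner_neq0 // rmorph1 divr1.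
Qed.

Definition isomorphic (R S : idomainType) : Prop :=
  exists f : {rmorphism R -> S}, bijective f.

Lemma isomorphic_sym (R S : idomainType) : isomorphic R S -> isomorphic S R.
Proof.
case=> f [g fK gK].
pose zm := GRing.isZmodMorphism.Build _ _ g (can2_zmod_morphism fK gK).
pose mm := GRing.isMonoidMorphism.Build _ _ g (can2_monoid_morphism fK gK).
pose gr : {rmorphism S -> R} := HB.pack g zm mm.
by exists gr; exists f.
Qed.

Lemma subring_dom_isomorphic (K L : fieldType) (S : subringClosed K)
    (S' : subringClosed L) (h : {rmorphism K -> L}) :
    (forall x, x \in S -> h x \in S') ->
    (forall y, y \in S' -> exists2 x, x \in S & h x = y) ->
  isomorphic (subring_dom S) (subring_dom S').
Proof.
move=> hS hS'.
pose f (u : subring_dom S) : subring_dom S' := SubringDom (hS _ (valP u)).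
have fB : zmod_morphism f.
  by move=> u v; apply: val_inj; rewrite rmorphB /= !rmorphB.
have fM : monoid_morphism f.
  split=> [|u v]; apply: val_inj; first by rewrite rmorph1 /= !rmorph1.
  by rewrite rmorphM /= !rmorphM.
pose zm := GRing.isZmodMorphism.Build _ _ f fB.
pose mm := GRing.isMonoidMorphism.Build _ _ f fM.
pose fr : {rmorphism subring_dom S -> subring_dom S'} := HB.pack f zm mm.
have /choice[g gK] (v : subring_dom S') : exists u, f u = v.
  have [x xS xv] := hS' _ (valP v).
  by exists (SubringDom xS); apply: val_inj; rewrite /= xv.
exists fr; exists g => // u; apply: val_inj; apply: (fmorph_inj h).
have := congr1 val (gK (f u)); exact.
Qed.

(** * Localizations of a ring of fractions *)

Section RingOfFractions.
Variables (D : idomainType) (S : subringClosed {fraction D}).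
Hypothesis D_sub_S : forall d : D, tofrac d \in S.
Hypothesis S_fraction : forall x, x \in S ->
  exists d u : D, [/\ u != 0, (tofrac u)^-1 \in S & x = tofrac d / tofrac u].

Local Notation T := (subring_dom S).
Definition embed (d : D) : T := SubringDom (D_sub_S d).
Local Notation "d %:T" := (embed d).

Lemma embed1 : 1%:T = 1.
Proof. by apply: val_inj; rewrite rmorph1 [LHS]tofrac1. Qed.

Lemma embedB : {morph embed : d e / d - e}.
Proof. by move=> d e; apply: val_inj; rewrite rmorphB [LHS]tofracB. Qed.

Lemma embedM : {morph embed : d e / d * e}.
Proof. by move=> d e; apply: val_inj; rewrite rmorphM [LHS]tofracM. Qed.

Lemma embed0 : 0%:T = 0.
Proof. by rewrite -(subrr 1) embedB subrr. Qed.

Lemma unit_notin_prime (Q : prime_idealr T) (u : D) :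
  u != 0 -> (tofrac u)^-1 \in S -> u%:T \notin Q.
Proof.
move=> u0 uS; apply/negP => uQ; have := idealMr (SubringDom uS) uQ.
set v := _ * _; have -> : v = 1; last by rewrite idealr1.
by apply: val_inj; rewrite rmorphM rmorph1 /= mulVf // tofrac_eq0.
Qed.

Definition lies_over (Q : prime_idealr T) (P : prime_idealr D) :=
  forall d : D, (d%:T \in Q) = (d \in P).

(** A quotient [(d / u) / (e / v)] of elements of [T] with denominator outside [Q]
    equals [(d * v) / (u * e)]; here [u] is outside [Q] as a unit of [T], and [e]
    is outside [Q] as the product of [e / v] with the unit [v]. So [u * e] is
    outside [P], and the fraction lies in [D_P]. *)
Lemma lies_over_localization Q P :
  lies_over Q P -> isomorphic (localization Q) (localization P).
Proof.
move=> QP.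
have [h hE] : exists h : {rmorphism {fraction T} -> {fraction D}},
    forall t, h (tofrac t) = val t.
  exact: (fraction_extension (g := val : {rmorphism T -> {fraction D}}) val_inj).
apply: (subring_dom_isomorphic (h := h)) => [x|y] /asboolP.
  move=> [t [s [sQ ->]]]; rewrite fmorph_div !hE.
  have [d [u [u0 uS td]]] := S_fraction (valP t).
  have [e [v [v0 vS se]]] := S_fraction (valP s).
  have uQ : u%:T \notin Q by exact: unit_notin_prime.
  have eQ : e%:T \notin Q.
    have -> : e%:T = s * v%:T.
      by apply: val_inj; rewrite rmorphM /= se divfK // tofrac_eq0.
    by rewrite prime_idealrM negb_or sQ unit_notin_prime.
  apply/asboolP; exists (d * v), (u * e); split.
    by rewrite -QP embedM prime_idealrM negb_or uQ eQ.
  by rewrite td se invf_div mulf_div !tofracM.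
move=> [d [s [sP ->]]]; exists (tofrac d%:T / tofrac s%:T).
  by apply/asboolP; exists d%:T, s%:T; rewrite QP.
by rewrite fmorph_div !hE.
Qed.

Lemma contraction_prime (Q : prime_idealr T) : exists P, lies_over Q P.
Proof.
pose I : {pred D} := [pred d | d%:T \in Q].
have I_zmod : zmod_closed I.
  by split=> [|d e]; rewrite !inE ?embed0 ?idealr0 // embedB; apply: rpredB.
have I_proper : ring_quotient.proper_ideal I.
  split=> [|d e]; rewrite !inE; first by rewrite embed1 idealr1.
  by rewrite embedM; apply: idealMr.
have I_prime : prime_idealr_closed I.
  by move=> d e; rewrite !inE embedM prime_idealrM.
pose zm := GRing.isZmodClosed.Build _ I I_zmod.
pose pm := isProperIdeal.Build _ I I_proper.
pose qm := isPrimeIdealrClosed.Build _ I I_prime.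
pose P : prime_idealr D := HB.pack (I : D -> bool) zm pm qm.
by exists P.
Qed.

(** The prime is the trace on [T] of the maximal ideal of [D_P]. As [T] is
    contained in [D_P], membership can be tested on the numerator of any fraction
    with denominator outside [P], which reduces everything to [P]. *)
Lemma extension_prime (P : prime_idealr D) :
  {subset S <= localization_set P} -> exists Q, lies_over Q P.
Proof.
move=> SP.
have nz s : s \notin P -> tofrac s != 0.
  by apply: contraNneq => /eqP; rewrite tofrac_eq0 => /eqP ->; rewrite idealr0.
pose J : {pred T} := [pred t : T |
  `[< exists p s, [/\ p \in P, s \notin P & subring_val t = tofrac p / tofrac s] >]].
have JE (t : T) d s : s \notin P -> subring_val t = tofrac d / tofrac s ->
    (t \in J) = (d \in P).
  move=> sP tE; apply/asboolP/idP => [[p [r [pP rP]]]|dP]; last by exists d, s.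
  rewrite tE => /eqP; rewrite eqr_div ?nz // -!tofracM tofrac_eq => /eqP e.
  have := idealMr s pP; rewrite mulrC -e prime_idealrM.
  by rewrite (negPf rP) orbF.
have J_zmod : zmod_closed J.
  split=> [|t t'].
    by rewrite (@JE 0 0 1) ?idealr0 ?idealr1 // tofrac0 mul0r.
  move=> /asboolP[p [s [pP sP tE]]] /asboolP[q [r [qP rP t'E]]].
  rewrite (@JE _ (p * r - q * s) (s * r)) ?prime_idealrM ?negb_or ?sP //.
    by rewrite rpredB // mulrC idealMr.
  rewrite -[LHS]/(val _) rmorphB /= tE t'E -[in LHS]mulNr addf_div ?nz //.
  by rewrite tofracB !tofracM mulNr.
have J_proper : ring_quotient.proper_ideal J.
  split=> [|t t' /asboolP[p [s [pP sP t'E]]]].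
    by rewrite (@JE 1 1 1) ?idealr1 // tofrac1 divr1.
  have /asboolP[d [r [rP tE]]] := SP _ (valP t).
  rewrite (@JE _ (d * p) (r * s)); first exact: idealMr.
    by rewrite prime_idealrM negb_or rP.
  by rewrite -[LHS]/(val _) rmorphM /= tE t'E mulf_div !tofracM.
have J_prime : prime_idealr_closed J.
  move=> t t'.
  have /asboolP[d [s [sP tE]]] := SP _ (valP t).
  have /asboolP[e [r [rP t'E]]] := SP _ (valP t').
  rewrite (JE _ _ _ sP tE) (JE _ _ _ rP t'E) -prime_idealrM.
  rewrite (@JE _ (d * e) (s * r)) ?prime_idealrM ?negb_or ?sP //.
  by rewrite -[LHS]/(val _) rmorphM /= tE t'E mulf_div !tofracM.
pose zm := GRing.isZmodClosed.Build _ J J_zmod.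
pose pm := isProperIdeal.Build _ J J_proper.
pose qm := isPrimeIdealrClosed.Build _ J J_prime.
pose Q : prime_idealr T := HB.pack (J : T -> bool) zm pm qm.
exists Q => d.
by rewrite -(@JE d%:T d 1) ?idealr1 //= tofrac1 divr1.
Qed.

End RingOfFractions.

(** * The Nagata transform of a principal ideal *)

Section PrincipalNagata.
Variables (D : idomainType) (a : D).

Lemma ideal_exp_principal n x :
  x \in ideal_exp (principal_ideal a) n <-> exists r, x = r * a ^+ n.
Proof.
elim: n x => [|n IH] x; first by split=> // _; exists x; rewrite mulr1.
split=> [/asboolP[s [sI ->]]|[r ->]].
  rewrite big_seq; elim/big_ind: _ => [|_ _ [r ->] [r' ->]|p /sI[]].
  - by exists 0; rewrite mul0r.
  - by exists (r + r'); rewrite mulrDl.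
  - move=> /asboolP[r ->] /IH[r' ->].
    by exists (r * r'); rewrite mulrACA -exprS.
apply/asboolP; exists [:: (r * a, a ^+ n)]; split; last first.
  by rewrite big_seq1 /= exprS mulrA.
move=> p; rewrite inE => /eqP -> /=; split; first by apply/asboolP; exists r.
by apply/IH; exists 1; rewrite mul1r.
Qed.

Lemma nagata_principalP (x : {fraction D}) :
  x \in nagata_set (principal_ideal a) <->
  exists n d, x * tofrac (a ^+ n) = tofrac d.
Proof.
split=> [/asboolP[n /asboolP xn]|[n [d xd]]].
  have [|d xd] := xn (a ^+ n); last by exists n, d.
  by apply/ideal_exp_principal; exists 1; rewrite mul1r.
apply/asboolP; exists n; apply/asboolP => j /ideal_exp_principal[r ->].
by exists (r * d); rewrite !tofracM mulrCA xd.
Qed.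

Lemma sub_nagata (d : D) : tofrac d \in nagata_set (principal_ideal a).
Proof. by apply/nagata_principalP; exists 0, d; rewrite tofrac1 mulr1. Qed.

(** If [a] is nonzero, the denominators are the powers of [a]; if [a = 0], the
    transform is the whole quotient field and every denominator will do. *)
Lemma nagata_principal_fraction x : x \in nagata_set (principal_ideal a) ->
  exists d u : D, [/\ u != 0,
    (tofrac u)^-1 \in nagata_set (principal_ideal a) & x = tofrac d / tofrac u].
Proof.
have [a0 _|a0] := eqVneq a 0.
  have [d [u [u0 ->]]] := fractionP x; exists d, u; split=> //.
  by apply/nagata_principalP; exists 1, 0; rewrite a0 tofrac0 mulr0.
move=> /nagata_principalP[n [d xd]].
have an0 : tofrac (a ^+ n) != 0 by rewrite tofrac_eq0 expf_neq0.
exists d, (a ^+ n); rewrite -xd mulfK // -(tofrac_eq0 (a ^+ n)) an0; split=> //.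
by apply/nagata_principalP; exists n, 1; rewrite mulVf.
Qed.

Lemma nagata_sub_localization (P : prime_idealr D) : a \notin P ->
  {subset nagata_set (principal_ideal a) <= localization_set P}.
Proof.
move=> aP x /nagata_principalP[n [d xd]].
have anP : a ^+ n \notin P.
  elim: n {xd} => [|n IH]; first by rewrite idealr1.
  by rewrite exprS prime_idealrM negb_or aP.
apply/asboolP; exists d, (a ^+ n); split=> //; rewrite -xd mulfK // tofrac_eq0.
by apply: contraNneq anP => ->; rewrite idealr0.
Qed.

End PrincipalNagata.

(** * Nonunits outside a proper ideal *)

(** If [P] contained every nonunit it would contain every proper ideal, hence be
    the unique maximal ideal. *)
Lemma nonunit_notin_ideal (D : idomainType) (P : idealr D) :
  ~ quasi_local D -> exists2 a, a \isn't a GRing.unit & a \notin P.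
Proof.
move=> notql; apply: contrapT => noa; apply: notql.
have proper (N : idealr D) : {subset N <= P}.
  move=> x xN; apply/negP => /negP xP; apply: noa; exists x => //.
  by apply/negP => xU; have := idealMr x^-1 xN; rewrite mulVr // idealr1.
have Pmax : maximal_ideal P.
  by move=> J PJ x; apply/idP/idP; [exact: proper | exact: PJ].
exists P; split=> // N Nmax x; apply/idP/idP; first exact: proper.
by rewrite (Nmax P).
Qed.

Theorem proposition2p5 (D : idomainType) (X : idomainType -> Prop)
    (hD : ~ quasi_local D) (hX : iso_invariant X) :
  locally X D <->
  (forall a : D, a \isn't a GRing.unit ->
     locally X (nagata_transform (principal_ideal a))).
Proof.
have iso a Q P := lies_over_localization
  (@nagata_principal_fraction D a) (Q := Q) (P := P) (D_sub_S := @sub_nagata D a).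
split=> [DX a _ Q|TX P].
  have [P QP] := contraction_prime (@sub_nagata D a) Q.
  exact: hX (isomorphic_sym (iso _ _ _ QP)) (DX P).
have [a aU aP] := nonunit_notin_ideal P hD.
have [Q QP] := extension_prime (@sub_nagata D a)
  (nagata_sub_localization aP).
exact: hX (iso _ _ _ QP) (TX a aU Q).
Qed.
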